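(* Let $\{X_i\}_{i\in\Gamma}$ be an arbitrary family of Banach spaces (with $\Gamma$ an arbitrary index set) such that each $X_i$ has the weak Lebesgue property. Then the $\ell_1$-sum $\left(\bigoplus_{i\in\Gamma}X_i\right)_{\ell_1}$ has the weak Lebesgue property.
   Context: All Banach spaces are real. A tagged partition of $[0,1]$ is a finite collection $\mathcal P=\{(s_i,[t_{i-1},t_i]):1\le i\le N\}$, where the $[t_{i-1},t_i]$ are non-overlapping closed intervals covering $[0,1]$ and $s_i\in(t_{i-1},t_i)$; its norm is $\max_i(t_i-t_{i-1})$, and for $f:[0,1]\to X$ one puts $f(\mathcal P)=\sum_{i=1}^N (t_i-t_{i-1})f(s_i)$. A function $f:[0,1]\to X$ into a Banach space $X$ is Riemann integrable, with integral $x\in X$, if for every $\varepsilon>0$ there is $\delta>0$ such that $\|f(\mathcal P)-x\|<\varepsilon$ for all tagged partitions $\mathcal P$ of $[0,1]$ with norm less than $\delta$. A Banach space $X$ has the weak Lebesgue property (WLP) if every Riemann integrable $f:[0,1]\to X$ is weakly continuous almost everywhere, i.e. the set of points of $[0,1]$ at which $f$ is not continuous with respect to the weak topology of $X$ has Lebesgue measure zero. *)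

(* Defs.v *)
From HB Require Import structures.
From mathcomp Require Import all_boot all_order all_algebra finmap.
From mathcomp Require Import all_classical all_reals all_analysis.

Set Implicit Arguments.
Unset Strict Implicit.
Unset Printing Implicit Defensive.

Import Order.TTheory GRing.Theory Num.Theory.
Import numFieldNormedType.Exports.

Local Open Scope classical_set_scope.
Local Open Scope ring_scope.

(* A tagged partition 0 = t_0 < t_1 < ... < t_N = 1 with tags
   s_i \in ]t_i, t_{i+1}[ for 0 <= i < N.  The list tp_nodes is [t_1; ...; t_N],
   the left end point 0 being implicit as in itv_partition; the values of tp_tag
   outside of {0, ..., N-1} are irrelevant. *)
Record tagged_partition (R : realType) := TaggedPartition {
  tp_nodes : seq R;
  tp_tag : nat -> R;
  tp_nodesP : itv_partition 0 1 tp_nodes;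
  tp_tagP : forall i, (i < size tp_nodes)%N ->
    nth 1 (0 :: tp_nodes) i < tp_tag i < nth 1 (0 :: tp_nodes) i.+1 }.

Section riemann_integral.
Variables (R : realType) (X : normedModType R).

Definition tp_size (P : tagged_partition R) : nat := size (tp_nodes P).

Definition tp_node (P : tagged_partition R) (i : nat) : R :=
  nth 1 (0 :: tp_nodes P) i.

Definition tp_norm (P : tagged_partition R) : R :=
  \big[Num.max/0]_(0 <= i < tp_size P) (tp_node P i.+1 - tp_node P i).

Definition riemann_sum (f : R -> X) (P : tagged_partition R) : X :=
  \sum_(0 <= i < tp_size P) (tp_node P i.+1 - tp_node P i) *: f (tp_tag P i).

(* Functions on [0, 1] are represented by functions on R, whose values outside
   of [0, 1] play no role here and in weakly_continuous_at01. *)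
Definition is_riemann_integral (f : R -> X) (x : X) : Prop :=
  forall e : R, 0 < e -> exists2 d : R, 0 < d &
    forall P : tagged_partition R, tp_norm P < d -> `|riemann_sum f P - x| < e.

Definition riemann_integrable (f : R -> X) : Prop :=
  exists x : X, is_riemann_integral f x.

End riemann_integral.

Section weak_topology.
Variables (R : realType) (X : normedModType R).

Definition continuous_dual := {phi : {linear X -> R^o} | continuous phi}.

(* The coarsest topology on X making every continuous functional continuous. *)
Definition weak_topology : topologicalType :=
  sup_topology (fun phi : continuous_dual =>
    Topological.class (initial_topology (sval phi : X -> R^o))).

Definition weakly_continuous_at01 (f : R -> X) (t : R) : Prop :=
  (f : R -> weak_topology) @ within `[0, 1] (nbhs t)
    --> (f t : weak_topology).

End weak_topology.

Definition weak_lebesgue_property (R : realType) (X : completeNormedModType R)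
    : Prop :=
  forall f : R -> X, riemann_integrable f ->
    (@lebesgue_measure R).-negligible
      [set t | t \in `[0, 1] /\ ~ weakly_continuous_at01 f t].

(* esum requires a choiceType of indices, whence {classic Gamma}. *)
Definition l1_esum (R : realType) (Gamma : Type)
    (X : Gamma -> completeNormedModType R) (x : forall i, X i) : \bar R :=
  \esum_(i in [set: {classic Gamma}]) `|x i|%:E.

Record l1_sum (R : realType) (Gamma : Type)
    (X : Gamma -> completeNormedModType R) := L1Sum {
  l1_val :> forall i : Gamma, X i;
  l1_valP : (l1_esum l1_val < +oo)%E }.

Section l1_esum_theory.
Variables (R : realType) (Gamma : Type) (X : Gamma -> completeNormedModType R).
Implicit Types x y : forall i, X i.

Lemma l1_esum_ge0 x : (0 <= l1_esum x)%E.
Proof. by apply: esum_ge0 => i _; rewrite lee_fin. Qed.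

Lemma l1_esum_leP x (c : R) : (l1_esum x <= c%:E)%E <->
  forall s : seq {classic Gamma}, uniq s -> \sum_(i <- s) `|x i| <= c.
Proof.
split=> [xc s us|xc].
  rewrite -lee_fin -sumEFin; apply: le_trans xc.
  apply: esum_ge; exists [set` s]; first by split => //; exact: finite_seq.
  by rewrite fsbig_seq.
apply: ge_ereal_sup => _ [A [finA _] <-].
by rewrite fsbig_finite//= sumEFin lee_fin; apply: xc; exact: fset_uniq.
Qed.

Lemma l1_esum_fineP x : (l1_esum x < +oo)%E ->
  l1_esum x = (fine (l1_esum x))%:E.
Proof. by move=> xoo; rewrite fineK// ge0_fin_numE// l1_esum_ge0. Qed.

Lemma l1_esumD x y : (l1_esum x < +oo)%E -> (l1_esum y < +oo)%E ->
  (l1_esum (fun i => (x i + y i)%R) <=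
    (fine (l1_esum x) + fine (l1_esum y))%R%:E)%E.
Proof.
move=> xoo yoo; apply/l1_esum_leP => s us.
have /l1_esum_leP/(_ s us) hx : (l1_esum x <= (fine (l1_esum x))%:E)%E.
  by rewrite -l1_esum_fineP.
have /l1_esum_leP/(_ s us) hy : (l1_esum y <= (fine (l1_esum y))%:E)%E.
  by rewrite -l1_esum_fineP.
apply: le_trans (lerD hx hy).
by rewrite -big_split/=; apply: ler_sum => i _; exact: ler_normD.
Qed.

Lemma l1_esumZ (a : R) x : (l1_esum x < +oo)%E ->
  (l1_esum (fun i => (a *: x i)%R) <= (`|a| * fine (l1_esum x))%R%:E)%E.
Proof.
move=> xoo; apply/l1_esum_leP => s us.
have /l1_esum_leP/(_ s us) hx : (l1_esum x <= (fine (l1_esum x))%:E)%E.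
  by rewrite -l1_esum_fineP.
apply: le_trans (ler_wpM2l (normr_ge0 a) hx).
by rewrite mulr_sumr; apply: ler_sum => i _; rewrite normrZ.
Qed.

Lemma l1_esum0 : l1_esum (fun i => 0%R : X i) = 0%E.
Proof. by apply: esum1 => i _; rewrite normr0. Qed.

Lemma norm_le_l1_esum x i : (`|x i|%:E <= l1_esum x)%E.
Proof.
apply: esum_ge; exists [set (i : {classic Gamma})].
  by split => //; exact: finite_set1.
by rewrite fsbig_set1.
Qed.

End l1_esum_theory.

Section l1_sum_lmodule.
Variables (R : realType) (Gamma : Type) (X : Gamma -> completeNormedModType R).
Local Notation l1 := (l1_sum X).
Implicit Types x y z : l1.

HB.instance Definition _ := gen_eqMixin l1.
HB.instance Definition _ := gen_choiceMixin l1.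

Lemma l1_eqP x y : (forall i, x i = y i) -> x = y.
Proof.
case: x y => [x xP] [y yP]/= xy.
have {}xy : x = y by exact: functional_extensionality_dep.
by subst y; congr L1Sum; exact: Prop_irrelevance.
Qed.

Lemma l1_zero_subproof : (l1_esum (fun i => 0%R : X i) < +oo)%E.
Proof. by rewrite l1_esum0. Qed.

Lemma l1_add_subproof x y : (l1_esum (fun i => (x i + y i)%R) < +oo)%E.
Proof. by apply: le_lt_trans (l1_esumD (l1_valP x) (l1_valP y)) _; rewrite ltry. Qed.

Lemma l1_scale_subproof (a : R) x : (l1_esum (fun i => (a *: x i)%R) < +oo)%E.
Proof. by apply: le_lt_trans (l1_esumZ a (l1_valP x)) _; rewrite ltry. Qed.

Lemma l1_opp_subproof x : (l1_esum (fun i => (- x i)%R) < +oo)%E.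
Proof.
have := l1_scale_subproof (-1) x; congr (l1_esum _ < _)%E.
by apply: functional_extensionality_dep => i; rewrite scaleN1r.
Qed.

Definition l1_zero : l1 := L1Sum l1_zero_subproof.
Definition l1_add x y : l1 := L1Sum (l1_add_subproof x y).
Definition l1_opp x : l1 := L1Sum (l1_opp_subproof x).
Definition l1_scale (a : R) x : l1 := L1Sum (l1_scale_subproof a x).

Let addA : associative l1_add.
Proof. by move=> x y z; apply: l1_eqP => i; exact: addrA. Qed.
Let addC : commutative l1_add.
Proof. by move=> x y; apply: l1_eqP => i; exact: addrC. Qed.
Let add0 : left_id l1_zero l1_add.
Proof. by move=> x; apply: l1_eqP => i; exact: add0r. Qed.
Let addN : left_inverse l1_zero l1_opp l1_add.
Proof. by move=> x; apply: l1_eqP => i; exact: addNr. Qed.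

HB.instance Definition _ := GRing.isZmodule.Build l1 addA addC add0 addN.

Let scaleA (a b : R) x : l1_scale a (l1_scale b x) = l1_scale (a * b) x.
Proof. by apply: l1_eqP => i; exact: scalerA. Qed.
Let scale1 : left_id 1 l1_scale.
Proof. by move=> x; apply: l1_eqP => i; exact: scale1r. Qed.
Let scaleDr : right_distributive l1_scale +%R.
Proof. by move=> a x y; apply: l1_eqP => i; exact: scalerDr. Qed.
Let scaleDl x : {morph l1_scale^~ x : a b / a + b}.
Proof. by move=> a b; apply: l1_eqP => i; exact: scalerDl. Qed.

HB.instance Definition _ := GRing.Zmodule_isLmodule.Build R l1
  scaleA scale1 scaleDr scaleDl.

Definition l1_norm x : R := fine (l1_esum x).

Lemma l1_norm_esum x : (l1_norm x)%:E = l1_esum x.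
Proof. by rewrite -l1_esum_fineP//; exact: l1_valP. Qed.

Lemma l1_norm_leP x (c : R) : l1_norm x <= c <->
  forall s : seq {classic Gamma}, uniq s -> \sum_(i <- s) `|x i| <= c.
Proof. by rewrite -lee_fin l1_norm_esum; exact: l1_esum_leP. Qed.

Lemma norm_le_l1_norm x i : `|x i| <= l1_norm x.
Proof. by rewrite -lee_fin l1_norm_esum; exact: norm_le_l1_esum. Qed.

Let normD x y : l1_norm (x + y) <= l1_norm x + l1_norm y.
Proof.
by rewrite -lee_fin l1_norm_esum; exact: l1_esumD (l1_valP x) (l1_valP y).
Qed.

Let normZ_le (a : R) x : l1_norm (a *: x) <= `|a| * l1_norm x.
Proof. by rewrite -lee_fin l1_norm_esum; exact: l1_esumZ (l1_valP x). Qed.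

Let normZ (a : R) x : l1_norm (a *: x) = `|a| * l1_norm x.
Proof.
apply/eqP; rewrite eq_le normZ_le/=.
have [->|a0] := eqVneq a 0.
  by rewrite normr0 mul0r -lee_fin l1_norm_esum l1_esum_ge0.
rewrite mulrC -ler_pdivlMr ?normr_gt0// mulrC.
by have := normZ_le a^-1 (a *: x); rewrite scalerA mulVf// scale1r normfV.
Qed.

Let norm_eq0 x : l1_norm x = 0 -> x = 0.
Proof.
move=> x0; apply: l1_eqP => i; apply/eqP.
by rewrite -normr_le0 -x0 norm_le_l1_norm.
Qed.

HB.instance Definition _ :=
  Lmodule_isNormed.Build R l1 normD normZ norm_eq0.

Lemma l1_normE x : `|x| = l1_norm x. Proof. by []. Qed.

End l1_sum_lmodule.

Section l1_sum_complete.
Variables (R : realType) (Gamma : Type) (X : Gamma -> completeNormedModType R).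
Local Notation l1 := (l1_sum X).

Let l1_complete (F : set_system l1) : ProperFilter F -> cauchy F -> cvg F.
Proof.
move=> FF /cauchy_ballP Fc.
have Fc' (e : R) : 0 < e -> \forall x & y \near F, `|x - y| < e.
  by move=> e0; have := Fc _ e0; rewrite -ball_normE.
have cvgi (i : Gamma) : cvg ((fun x : l1 => x i) @ F).
  apply: cauchy_cvg; apply/cauchy_ballP => e e0.
  rewrite near_map2; have := Fc' _ e0; apply: filterS => -[x y]/= xy.
  rewrite -ball_normE/=; apply: le_lt_trans xy.
  exact: (norm_le_l1_norm (x - y) i).
pose l (i : Gamma) : X i := lim ((fun x : l1 => x i) @ F).
have key (e : R) : 0 < e -> F [set x : l1 | forall s : seq {classic Gamma},
    uniq s -> \sum_(i <- s) `|l i - x i| <= e].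
  move=> e0; have [[P Q]/= [FP FQ] PQ] := Fc' _ e0.
  apply: filterS FP => x Px s us.
  have cs : (fun y : l1 => \sum_(i <- s) `|y i - x i|) @ F -->
      \sum_(i <- s) `|l i - x i|.
    elim: s {us} => [|i s IHs].
      by under eq_cvg do rewrite big_nil; rewrite big_nil; exact: cvg_cst.
    under eq_cvg do rewrite big_cons; rewrite big_cons; apply: cvgD IHs.
    by apply: cvg_norm; apply: cvgB; [exact: cvgi|exact: cvg_cst].
  rewrite -(cvg_lim _ cs)//; apply: limr_le; first exact: (cvgP _ cs).
  apply: filterS FQ => y Qy.
  have := PQ (x, y) (conj Px Qy); rewrite /= distrC => /ltW/l1_norm_leP.
  exact.
have [x0 hx0] : exists x0 : l1, forall s : seq {classic Gamma}, uniq s ->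
    \sum_(i <- s) `|l i - x0 i| <= 1.
  by have /filter_ex := key _ (@ltr01 R).
have lP : (l1_esum l < +oo)%E.
  apply: (@le_lt_trans _ _ ((1 + `|x0|)%:E)); last by rewrite ltry.
  apply/l1_esum_leP => s us.
  have h2 : \sum_(i <- s) `|x0 i| <= `|x0| by apply: (l1_norm_leP x0 _).1 us; exact: lexx.
  apply: le_trans (lerD (hx0 s us) h2).
  rewrite -big_split/=; apply: ler_sum => i _.
  by apply: le_trans (ler_normD _ _); rewrite subrK.
apply/cvg_ex; exists (L1Sum lP); apply/cvgrPdist_le => e e0.
apply: filterS (key _ e0) => x xe.
by rewrite l1_normE; apply/l1_norm_leP.
Qed.

HB.instance Definition _ := Uniform_isComplete.Build l1 l1_complete.

End l1_sum_complete.

(* Main.v *)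
From HB Require Import structures.
Require Import Defs.
From mathcomp Require Import all_boot all_order all_algebra ring lra.
From mathcomp Require Import all_classical all_reals all_analysis measurable_realfun.

(* Let f be Riemann integrable with values in the l1-sum.  For e > 0, the points
   near which all but finitely many coordinates of f have total norm at most e
   form an open set G_e.  If [0, 1] \ G_e had positive measure, a positive
   proportion of the cells of any uniform partition would meet it; a gliding
   hump, in which at each cell the two available tags are distributed over two
   tagged partitions so that the new difference does not decrease the norm
   already reached, would then produce Riemann sums of f whose difference stays
   away from 0.  So almost every t lies in all the G_e.  Covering each G_e by
   rational intervals, only countably many coordinates are ever needed to
   approximate f near such points, and f is weakly continuous at t as soon as
   these coordinates are, which happens almost everywhere. *)

Set Implicit Arguments.
Unset Strict Implicit.
Unset Printing Implicit Defensive.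

Import Order.TTheory GRing.Theory Num.Theory.
Import numFieldNormedType.Exports.

Local Open Scope classical_set_scope.
Local Open Scope ring_scope.

(** * Tails of elements of the l1-sum and the gliding hump *)

Section l1_tail.
Variables (R : realType) (Gamma : Type) (X : Gamma -> completeNormedModType R).
Local Notation I := {classic Gamma}.
Implicit Types (x y : l1_sum X) (F : seq I).

(** The norm of [x] outside [F]; [undup] allows lists with repetitions, such as concatenations. *)
Definition l1_tail F x : R := `|x| - \sum_(i <- undup F) `|x i|.

Lemma l1_sum_le_norm F x : uniq F -> \sum_(i <- F) `|x i| <= `|x|.
Proof. by move=> uF; apply: (l1_norm_leP x _).1 uF; exact: lexx. Qed.

(** The tail is the supremum of the finite sums off [F]; this form gives subadditivity and
    monotonicity in [F] term by term. *)
Lemma l1_tail_leP F x (c : R) :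
  (forall s : seq I, uniq s -> {in s, forall i, i \notin F} ->
    \sum_(i <- s) `|x i| <= c) <-> l1_tail F x <= c.
Proof.
split=> [sc|Fc s us sF].
  rewrite lerBlDl l1_normE; apply/l1_norm_leP => s us.
  rewrite [leLHS](bigID (fun i => i \in F))/=.
  rewrite -[X in X + _ <= _]big_filter -[X in _ + X <= _]big_filter.
  apply: lerD; last first.
    by apply: sc => [|i]; rewrite ?filter_uniq// mem_filter => /andP[].
  have /(perm_big _)-> :
      perm_eq [seq i <- s | i \in F] [seq i <- undup F | i \in s].
    apply: uniq_perm; rewrite ?filter_uniq ?undup_uniq// => i.
    by rewrite !mem_filter mem_undup andbC.
  rewrite big_filter [leRHS](bigID (fun i => i \in s))/= lerDl; exact: sumr_ge0.
apply: le_trans Fc; rewrite lerBrDl -big_cat/=; apply: l1_sum_le_norm.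
rewrite cat_uniq undup_uniq us andbT/=; apply/hasPn => i /sF.
by rewrite mem_undup.
Qed.

Lemma l1_tailD F x y : l1_tail F (x + y) <= l1_tail F x + l1_tail F y.
Proof.
apply/l1_tail_leP => s us sF.
have /l1_tail_leP/(_ s us sF) hx := lexx (l1_tail F x).
have /l1_tail_leP/(_ s us sF) hy := lexx (l1_tail F y).
apply: le_trans (lerD hx hy); rewrite -big_split/=.
by apply: ler_sum => i _; exact: ler_normD.
Qed.

Lemma l1_tailN F x : l1_tail F (- x) = l1_tail F x.
Proof.
by rewrite /l1_tail normrN; congr (_ - _); apply: eq_bigr => i _; rewrite normrN.
Qed.

Lemma l1_tailB F x y : l1_tail F x - l1_tail F y <= l1_tail F (x - y).
Proof. by rewrite lerBlDr; apply: le_trans (l1_tailD _ _ _); rewrite subrK. Qed.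

Lemma l1_tail_sub F F' x : {subset F <= F'} -> l1_tail F' x <= l1_tail F x.
Proof.
move=> FF'; apply/l1_tail_leP => s us sF'.
have /l1_tail_leP := lexx (l1_tail F x); apply => // i /sF'.
by apply: contra; exact: FF'.
Qed.

(** Otherwise all finite sums, hence the norm of [x] itself, would be at most that norm minus
    [e]. *)
Lemma l1_tail_small x (e : R) : 0 < e -> exists F, l1_tail F x <= e.
Proof.
move=> e0; apply/not_existsP => tF.
have : `|x| <= `|x| - e.
  rewrite l1_normE; apply/l1_norm_leP => s us; have /negP := tF s.
  by rewrite -ltNge /l1_tail undup_id// ltrBrDl l1_normE => ?; lra.
by move=> ?; lra.
Qed.

(* The two inequalities [head S <= (head (S + D) + head (S - D)) / 2] and
   [tail (S +- D) >= tail D - tail S] are added. *)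
Lemma l1_norm_addsub F (S D : l1_sum X) :
  `|S| *+ 2 + l1_tail F D *+ 2 - l1_tail F S *+ 4 <= `|S + D| + `|S - D|.
Proof.
have hd : (\sum_(i <- undup F) `|S i|) *+ 2 <=
    \sum_(i <- undup F) `|(S + D) i| + \sum_(i <- undup F) `|(S - D) i|.
  rewrite -sumrMnl -big_split/=; apply: ler_sum => i _.
  apply: le_trans (ler_normD _ _).
  by rewrite addrACA subrr addr0 -mulr2n normrMn.
have := l1_tailB F D (- S); have := l1_tailB F (- D) (- S).
rewrite !opprK !l1_tailN [- D + S]addrC [D + S]addrC.
move: hd; rewrite /l1_tail; lra.
Qed.

(** With [D = x - y], the tail of [D] exceeds [5e/6], so the norms of [S + D] and [S - D] add up to
    more than twice that of [S] plus [10e/6 - 4e/6 = e]. *)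
Lemma l1_hump (S x y : l1_sum X) F (e : R) :
  l1_tail F S <= e / 6 -> l1_tail F y <= e / 6 -> e < l1_tail F x ->
  `|S| + e / 2 <= `|S + (x - y)| \/ `|S| + e / 2 <= `|S - (x - y)|.
Proof.
move=> tS ty tx; have := l1_norm_addsub F S (x - y); have := l1_tailB F x y.
have [?|?] := leP (`|S| + e / 2) `|S + (x - y)|; first by left.
move=> ? ?; right; lra.
Qed.

(* Exchanging the tags [u k] and [w k] flips the sign of one term of the sum. *)
Lemma l1_gliding_hump (T : Type) (f : T -> l1_sum X) (V : nat -> set T)
    (J : pred nat) (e : R) : 0 < e ->
  (forall k, V k !=set0) ->
  (forall k F, J k -> exists2 s, V k s & e < l1_tail F (f s)) ->
  forall N, exists u w : nat -> T, [/\ forall k, V k (u k),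
    forall k, V k (w k) &
    e / 2 * (\sum_(0 <= k < N) J k)%:R <=
    `|\sum_(0 <= k < N) (f (u k) - f (w k))|].
Proof.
move=> e0 V0 Jtail; have e6 : 0 < e / 6 by lra.
(* [v] provides a default tag per cell, which also plays the part of [y] in [l1_hump]. *)
have /choice[v Vv] : forall k, exists s, V k s by move=> k; exact: V0.
elim=> [|N [u [w [Vu Vw uw]]]].
  by exists v, v; split => //; rewrite !big_nil mulr0 normr0.
pose upd (u : nat -> T) s k := if k == N then s else u k.
have updV a s : (forall k, V k (a k)) -> V N s -> forall k, V k (upd a s k).
  by move=> Va Vs k; rewrite /upd; case: eqP => [->|_]; [exact: Vs|exact: Va].
have upd_sum a b s t : \sum_(0 <= k < N.+1) (f (upd a s k) - f (upd b t k)) =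
    \sum_(0 <= k < N) (f (a k) - f (b k)) + (f s - f t).
  rewrite big_nat_recr//= /upd eqxx; congr (_ + _).
  by apply: eq_big_nat => k /andP[_ kN]; rewrite ltn_eqF.
have [JN|JN] := boolP (J N); last first.
  exists (upd u (v N)), (upd w (v N)); split; [exact: updV|exact: updV|].
  by rewrite upd_sum subrr addr0 big_nat_recr//= (negbTE JN) addn0.
set S := \sum_(0 <= k < N) (f _ - _) in uw.
have [F1 tS] := l1_tail_small S e6; have [F2 tv] := l1_tail_small (f (v N)) e6.
(* [s] is chosen after [F1] and [F2], so that [f s] is large where [S] and [f (v N)] are small. *)
have [s Vs ts] := Jtail N (F1 ++ F2) JN.
have tS' : l1_tail (F1 ++ F2) S <= e / 6.
  by apply: le_trans (l1_tail_sub _ _) tS => i iF; rewrite mem_cat iF.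
have tv' : l1_tail (F1 ++ F2) (f (v N)) <= e / 6.
  by apply: le_trans (l1_tail_sub _ _) tv => i iF; rewrite mem_cat iF orbT.
have Jsum : e / 2 * (\sum_(0 <= k < N.+1) J k)%:R <= `|S| + e / 2.
  by rewrite big_nat_recr//= JN natrD mulrDr mulr1 lerD2r.
have [h|h] := l1_hump tS' tv' ts.
  exists (upd u s), (upd w (v N)); split; [exact: updV|exact: updV|].
  by rewrite upd_sum; exact: le_trans h.
exists (upd u (v N)), (upd w s); split; [exact: updV|exact: updV|].
by rewrite upd_sum; apply: (le_trans Jsum); rewrite -[f _ - f s]opprB.
Qed.

End l1_tail.

(** * Uniform partitions: Riemann sums and the measure of the cells met by a set *)

Section uniform_partition.
Variable R : realType.

Lemma uniform_tagged_partition (n : nat) (tag : nat -> R) :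
  (forall i, tag i \in `]i%:R / n.+1%:R, i.+1%:R / n.+1%:R[) ->
  exists P : tagged_partition R, tp_norm P = n.+1%:R^-1 /\
    forall (X : normedModType R) (f : R -> X),
      riemann_sum f P = n.+1%:R^-1 *: \sum_(0 <= i < n.+1) f (tag i).
Proof.
move=> tagP; pose s : seq R := mkseq (fun i => i.+1%:R / n.+1%:R) n.+1.
have sE i : (i <= n.+1)%N -> nth 1 (0 :: s) i = i%:R / n.+1%:R.
  case: i => [|i] ilen; first by rewrite mul0r.
  by rewrite /= -/s nth_mkseq.
have ss : size s = n.+1 by rewrite size_mkseq.
have sP : itv_partition 0 1 s.
  split; last by rewrite (last_nth 1) ss sE// divff.
  apply/(pathP 1) => i; rewrite ss => ilen.
  by rewrite sE ?(ltnW ilen)// nth_mkseq// ltr_pM2r ?invr_gt0// ltr_nat.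
have stag i : (i < size s)%N -> nth 1 (0 :: s) i < tag i < nth 1 (0 :: s) i.+1.
  by rewrite ss => ilen; rewrite !sE ?(ltnW ilen)//; have := tagP i; rewrite in_itv.
have step i : (i < n.+1)%N -> nth 1 (0 :: s) i.+1 - nth 1 (0 :: s) i = n.+1%:R^-1.
  move=> ilen; rewrite !sE ?(ltnW ilen)// -mulrBl -natrB// subSn// subnn.
  by rewrite mul1r.
exists (TaggedPartition sP stag); split=> [|X f].
  rewrite /tp_norm /tp_size /tp_node [tp_nodes _]/= ss.
  under eq_big_nat => i /andP[_ ilen] do rewrite step//.
  apply/eqP; rewrite eq_le; apply/andP; split; first exact: bigmax_le.
  by rewrite big_ltn// le_max lexx.
rewrite /riemann_sum /tp_size /tp_node [tp_nodes _]/= ss scaler_sumr.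
by apply: eq_big_nat => i /andP[_ ilen]; rewrite step.
Qed.

(** For a fine uniform partition, both choices of tags give Riemann sums within [e / 2] of the
    integral; the factor [n.+1] clears the cell length. *)
Lemma riemann_integrable_uniform (X : normedModType R) (f : R -> X) (e : R) :
  riemann_integrable f -> 0 < e -> exists n : nat, forall u w : nat -> R,
    (forall i, u i \in `]i%:R / n.+1%:R, i.+1%:R / n.+1%:R[) ->
    (forall i, w i \in `]i%:R / n.+1%:R, i.+1%:R / n.+1%:R[) ->
    `|\sum_(0 <= i < n.+1) (f (u i) - f (w i))| < e * n.+1%:R.
Proof.
move=> [x fx] e0; have [d d0 fd] := fx (e / 2) (divr_gt0 e0 (ltr0Sn _ _)).
exists (Num.truncn d^-1) => u w uP wP; set n := Num.truncn _ in uP wP *.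
have nd : n.+1%:R^-1 < d.
  by rewrite invf_plt ?posrE//; exact: truncnS_gt.
have [P [Pn Psum]] := uniform_tagged_partition uP.
have [Q [Qn Qsum]] := uniform_tagged_partition wP.
have := fd P; rewrite Pn => /(_ nd) fP; have := fd Q; rewrite Qn => /(_ nd) fQ.
rewrite -ltr_pdivrMr// mulrC -[X in X * _]ger0_norm ?invr_ge0// -normrZ.
rewrite big_split/= sumrN scalerBr -Psum -Qsum.
have -> : riemann_sum f P - riemann_sum f Q =
  (riemann_sum f P - x) - (riemann_sum f Q - x).
  by rewrite opprB addrA subrK.
by apply: le_lt_trans (ler_normB _ _) _; lra.
Qed.

(** Up to the division points, which form a null set, [E] is covered by the cells that it meets,
    each of length [1 / n.+1]. *)
Lemma measure_le_uniform_cells (n : nat) (E : set R) :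
  measurable E -> E `<=` `[0, 1] ->
  (lebesgue_measure E <= ((\sum_(0 <= k < n.+1)
    `[< E `&` `]k%:R / n.+1%:R, k.+1%:R / n.+1%:R[ !=set0 >] : nat)%:R /
    n.+1%:R)%:E)%E.
Proof.
move=> mE E01.
pose J (k : nat) : bool :=
  `[< E `&` `]k%:R / n.+1%:R, k.+1%:R / n.+1%:R[ !=set0 >].
pose A k : set R :=
  if J k then [set` `]k%:R / n.+1%:R, k.+1%:R / n.+1%:R[] else set0.
pose B : set R := range (fun k : nat => k%:R / n.+1%:R).
have cB : countable B by apply: card_image_le.
have mA k : measurable (A k) by rewrite /A; case: ifP.
have n0 : 0 < n.+1%:R :> R by [].
have EAB : E `<=` \big[setU/set0]_(k < n.+1) A k `|` B.
  move=> t Et; have /andP[t0 t1] : 0 <= t <= 1 by have := E01 _ Et; rewrite /= in_itv.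
  have tn0 : 0 <= t * n.+1%:R by rewrite mulr_ge0.
  have /andP[kt tk] := truncn_itv tn0; set k := Num.truncn _ in kt tk.
  have [tB|tB] := pselect (B t); [by right|left].
  have tk' : k%:R / n.+1%:R < t.
    rewrite lt_neqAle ler_pdivrMr// kt andbT; apply/eqP => tE.
    by apply: tB; exists k.
  have kt' : t < k.+1%:R / n.+1%:R by rewrite ltr_pdivlMr.
  have kn : (k < n.+1)%N.
    rewrite -(ltr_nat R) -[ltRHS]mul1r -ltr_pdivrMr//.
    exact: lt_le_trans t1.
  rewrite -bigcup_mkord; exists k => //; rewrite /A.
  have -> : J k by apply/asboolP; exists t; split => //=; rewrite in_itv/= tk'.
  by rewrite /= in_itv/= tk'.
have mB : measurable B by apply: countable_measurable => // t.
have mAU : measurable (\big[setU/set0]_(k < n.+1) A k).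
  exact: bigsetU_measurable.
apply: (@le_trans _ _ (lebesgue_measure (\big[setU/set0]_(k < n.+1) A k `|` B))).
  by apply: le_measure; rewrite ?inE//; exact: measurableU.
apply: (le_trans (measureU2 _ _ _)) => //.
rewrite [X in (_ + X)%E]countable_lebesgue_measure0// adde0.
apply: le_trans (Boole_inequality _ _) _ => [k _|]; first exact: mA.
rewrite big_mkord natr_sum mulr_suml -sumEFin; apply: lee_sum => k _; rewrite -/(J k).
rewrite /A; case: ifP => Jk; last by rewrite measure0 lee_fin mulr_ge0.
rewrite [leLHS]lebesgue_measure_itv/= lte_fin ltr_pM2r ?invr_gt0// ltr_nat ltnSn.
by rewrite -EFinB lee_fin -mulrBl -natrB// subSn// subnn.
Qed.

End uniform_partition.

(** * Coordinate injections and projections of the l1-sum *)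

Section l1_coordinates.
Variables (R : realType) (Gamma : Type) (X : Gamma -> completeNormedModType R).

Section l1_inj.
Variable i : Gamma.

(** [pselect] decides [i = j] classically, and [eq_rect] transports [a] to the type [X j]. *)
Definition l1_inj_fun (a : X i) (j : Gamma) : X j :=
  if pselect (i = j) is left e then eq_rect i (fun k => X k : Type) a j e else 0.

Lemma l1_inj_fun_eq (a : X i) : l1_inj_fun a i = a.
Proof.
rewrite /l1_inj_fun; case: pselect => // e.
by rewrite (Prop_irrelevance e (erefl i)).
Qed.

Lemma l1_inj_fun_neq (a : X i) j : i <> j -> l1_inj_fun a j = 0.
Proof. by rewrite /l1_inj_fun; case: pselect. Qed.

Lemma l1_esum_inj (a : X i) : (l1_esum (l1_inj_fun a) <= `|a|%:E)%E.
Proof.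
apply/l1_esum_leP => s us; have [si|si] := boolP ((i : {classic Gamma}) \in s).
  rewrite (bigD1_seq _ si us)/= l1_inj_fun_eq big1 ?addr0// => j /eqP ij.
  by rewrite l1_inj_fun_neq ?normr0// => /esym.
rewrite big_seq big1// => j js; rewrite l1_inj_fun_neq ?normr0// => ij.
by move: si; rewrite ij js.
Qed.

Lemma l1_inj_subproof (a : X i) : (l1_esum (l1_inj_fun a) < +oo)%E.
Proof. by apply: le_lt_trans (l1_esum_inj a) _; rewrite ltry. Qed.

Definition l1_inj (a : X i) : l1_sum X := L1Sum (l1_inj_subproof a).

Lemma l1_inj_is_linear : linear l1_inj.
Proof.
move=> c a b; apply: l1_eqP => j /=.
change (l1_inj_fun (c *: a + b) j = c *: l1_inj_fun a j + l1_inj_fun b j).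
have [ij|ij] := pselect (i = j); last by rewrite !l1_inj_fun_neq// scaler0 addr0.
by case: _ / ij; rewrite !l1_inj_fun_eq.
Qed.

HB.instance Definition _ :=
  GRing.isLinear.Build R (X i) (l1_sum X) _ l1_inj l1_inj_is_linear.

Lemma l1_inj_continuous : continuous l1_inj.
Proof.
move=> a; apply/cvgrPdist_le => e e0; near=> b.
rewrite -linearB; apply: (@le_trans _ _ `|a - b|).
  by rewrite l1_normE -lee_fin l1_norm_esum; exact: l1_esum_inj.
by near: b; exact: cvgr_dist_le.
Unshelve. all: by end_near. Qed.

End l1_inj.

Lemma l1_coord_sum (I : Type) (s : seq I) (x : I -> l1_sum X) i :
  (\sum_(k <- s) x k) i = \sum_(k <- s) x k i.
Proof. by elim: s => [|k s IHs]; rewrite ?big_nil// !big_cons -IHs. Qed.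

(** The difference vanishes on [F] and equals [x] elsewhere. *)
Lemma l1_sub_coords (F : seq {classic Gamma}) (x : l1_sum X) :
  `|x - \sum_(i <- undup F) l1_inj (x i)| <= l1_tail F x.
Proof.
rewrite l1_normE; apply/l1_norm_leP => s us.
have yE (j : {classic Gamma}) :
    x j - (\sum_(i <- undup F) l1_inj (x i)) j = if j \in F then 0 else x j.
  rewrite l1_coord_sum; case: ifPn => jF.
    rewrite (bigD1_seq (j : {classic Gamma})) ?mem_undup ?undup_uniq//=.
    rewrite l1_inj_fun_eq big1 ?addr0 ?subrr// => i /eqP ij.
    by rewrite l1_inj_fun_neq.
  rewrite big_seq big1 ?subr0// => i; rewrite mem_undup => iF.
  by apply: l1_inj_fun_neq => ij; move: jF; rewrite -ij iF.
have /l1_tail_leP tx := lexx (l1_tail F x).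
rewrite (bigID (fun j => j \in F))/= big1 ?add0r => [|j jF]; last first.
  by rewrite yE jF normr0.
rewrite -big_filter; apply: le_trans (tx [seq j <- s | j \notin F] _ _).
- rewrite le_eqVlt; apply/orP; left; apply/eqP/eq_big_seq => j.
  by rewrite mem_filter => /andP[jF _]; rewrite yE (negbTE jF).
- exact: filter_uniq.
- by move=> j; rewrite mem_filter => /andP[].
Qed.

(** Projecting onto a coordinate is linear and does not increase norms, so the same [d] serves. *)
Lemma riemann_integrable_coord (f : R -> l1_sum X) i :
  riemann_integrable f -> riemann_integrable (fun t => f t i).
Proof.
move=> [x fx]; exists (x i) => e /fx[d d0 fd]; exists d => // P /fd.
apply: le_lt_trans; apply: le_trans (norm_le_l1_norm _ i).
rewrite le_eqVlt; apply/orP; left; apply/eqP; congr `|_|.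
transitivity ((riemann_sum f P) i - x i) => //; congr (_ - _).
by rewrite /riemann_sum l1_coord_sum.
Qed.

End l1_coordinates.

(** * Weak continuity tested on functionals and on coordinates *)

Section weak_continuity.
Variable R : realType.

(** Convergence in a supremum of initial topologies is convergence in each of them. *)
Lemma weakly_continuous_at01P (X : normedModType R) (f : R -> X) (t : R) :
  weakly_continuous_at01 f t <->
  forall phi : continuous_dual X,
    (sval phi (f s) : R^o) @[s --> within `[0, 1] (nbhs t)] --> sval phi (f t).
Proof.
have FF : Filter (within `[0, 1] (nbhs t)) by exact: within_filter.
rewrite /weakly_continuous_at01 /weak_topology cvg_sup; split=> ft phi.
  by apply: cvg_comp (ft phi) _; exact: initial_continuous.
move=> A /=; rewrite /nbhs/= => -[_ [[B Bo <-] Bft] BA].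
have /(ft phi) : nbhs (sval phi (f t) : R^o) B by exact: open_nbhs_nbhs.
by apply: (@filterS _ _ FF) => s; exact: BA.
Qed.

(** Near [t], [phi (f s)] is uniformly close to a finite sum over [F] of functionals of single
    coordinates, each continuous at [t]. *)
Lemma l1_weakly_continuous_at01 (Gamma : Type)
    (X : Gamma -> completeNormedModType R) (f : R -> l1_sum X) (t : R) :
  t \in `[0, 1] ->
  (forall e, 0 < e -> exists F : seq {classic Gamma},
    (\forall s \near within `[0, 1] (nbhs t), l1_tail F (f s) <= e) /\
    {in F, forall i, weakly_continuous_at01 (fun s => f s i) t}) ->
  weakly_continuous_at01 f t.
Proof.
move=> t01 ft; apply/weakly_continuous_at01P => -[phi phic] /=.
have FF : Filter (within `[0, 1] (nbhs t)) by exact: within_filter.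
have [M M0 phiM] : exists2 M, 0 < M & forall x, `|phi x| <= M * `|x|.
  have /linear_boundedP bphi := @continuous_linear_bounded _ _ _ 0 phi (phic 0).
  near +oo_R => M; exists M; first by near: M; exact: nbhs_pinfty_gt.
  by near: M.
(* The error [e] splits into [e / 4] for each tail, at [s] and at [t], and [e / 2] for the finite
   sum. *)
apply/cvgrPdist_le => e e0; have e1 : 0 < e / (4 * M) by rewrite divr_gt0// mulr_gt0.
have [F [Ff fF]] := ft _ e1.
have cF : (\sum_(i <- undup F) phi (l1_inj (f s i)) : R^o)
    @[s --> within `[0, 1] (nbhs t)] --> (\sum_(i <- undup F) phi (l1_inj (f t i)) : R^o).
  have : {subset undup F <= F} by move=> i; rewrite mem_undup.
  elim: (undup F) => [_|i s IHs sF].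
    by under eq_cvg do rewrite big_nil; rewrite big_nil; exact: cvg_cst.
  under eq_cvg do rewrite big_cons; rewrite big_cons; apply: cvgD; last first.
    by apply: IHs => j js; apply: sF; rewrite inE js orbT.
  (* [phi] restricted to the [i]-th summand lies in the dual of [X i]. *)
  pose psi : {linear X i -> R^o} := phi \o @l1_inj _ _ X i.
  have psic : continuous psi.
    by move=> a; apply: continuous_comp; [exact: l1_inj_continuous|exact: phic].
  have /weakly_continuous_at01P fi := fF i (sF i (mem_head _ _)).
  exact: fi (exist _ psi psic).
have tail_phi s : l1_tail F (f s) <= e / (4 * M) ->
    `|phi (f s) - \sum_(i <- undup F) phi (l1_inj (f s i))| <= e / 4.
  move=> fs; rewrite -linear_sum -linearB; apply: le_trans (phiM _) _.
  apply: (@le_trans _ _ (M * (e / (4 * M)))).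
    by rewrite ler_pM2l//; exact: le_trans (l1_sub_coords _ _) fs.
  by rewrite le_eqVlt; apply/orP; left; apply/eqP; field; rewrite gt_eqF.
have ftF : l1_tail F (f t) <= e / (4 * M).
  by have := nbhs_singleton Ff; apply.
have e2 : 0 < e / 2 by rewrite divr_gt0.
have /cvgrPdist_le/(_ _ e2) cFe := cF.
apply: filterS2 Ff cFe => s /tail_phi; have := tail_phi _ ftF.
rewrite !ler_norml => /andP[? ?] /andP[? ?] /andP[? ?]; apply/andP; split; lra.
Unshelve. all: by end_near. Qed.

End weak_continuity.

(** * Points near which the tails of [f] are uniformly small *)

Section tail_points.
Variables (R : realType) (Gamma : Type) (X : Gamma -> completeNormedModType R).
Variable f : R -> l1_sum X.
Local Notation mu := (@lebesgue_measure R).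

Definition tail_le_on (U : set R) (F : seq {classic Gamma}) (e : R) : Prop :=
  forall s, U s -> s \in `[0, 1] -> l1_tail F (f s) <= e.

(** One [F] must serve a whole neighbourhood, which makes the set open and hence measurable. *)
Definition small_tail_set (e : R) : set R :=
  \bigcup_(U in [set U : set R | open U /\ exists F, tail_le_on U F e]) U.

(** If [q] of the [n.+1] cells meet the exceptional set, the gliding hump gives a difference of norm
    at least [e / 2 * q], while integrability keeps it below [e / 2 * d * n.+1]; thus the measure,
    at most [q / n.+1], is at most [d]. *)
Lemma measure_large_tail_set (e : R) : riemann_integrable f -> 0 < e ->
  mu (`[0, 1] `\` small_tail_set e) = 0%E.
Proof.
move=> fint e0; set E := _ `\` _.
have oG : open (small_tail_set e) by apply: bigcup_open => U [].
have mE : measurable E by apply: measurableD => //; exact: open_measurable.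
apply/eqP; rewrite eq_le measure_ge0 andbT; apply/lee_addgt0Pr => d d0.
rewrite add0e; have ed0 : 0 < e / 2 * d by rewrite mulr_gt0// divr_gt0.
have [n nf] := riemann_integrable_uniform fint ed0.
have n0 : 0 < n.+1%:R :> R by [].
pose cell (k : nat) : set R := [set` `]k%:R / n.+1%:R, k.+1%:R / n.+1%:R[].
pose J (k : nat) : bool := `[< E `&` cell k !=set0 >].
have cell0 k : cell k !=set0.
  exists ((k%:R / n.+1%:R + k.+1%:R / n.+1%:R) / 2).
  have ck : k%:R / n.+1%:R < k.+1%:R / n.+1%:R :> R.
    by rewrite ltr_pM2r ?invr_gt0// ltr_nat.
  by rewrite /cell/= in_itv/= !midf_lt.
(* If [F] left tails of at most [e] on the whole cell, the cell would lie in [small_tail_set e]. *)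
have Jtail k F : J k -> exists2 s, cell k s & e < l1_tail F (f s).
  move=> /asboolP[t [[t01 tG] tk]]; apply: contrapT => /forall2NP sF.
  apply: tG; exists (cell k) => //; split; first exact: interval_open.
  by exists F => s sk _; have [//|/negP] := sF s; rewrite -leNgt.
have [u [w [uP wP uw]]] := l1_gliding_hump e0 cell0 Jtail n.+1.
have E01 : E `<=` `[0, 1] by move=> t [].
apply: (le_trans (measure_le_uniform_cells n mE E01)); rewrite lee_fin.
rewrite ler_pdivrMr//; have e20 : 0 < e / 2 by rewrite divr_gt0.
rewrite -(ler_pM2l e20) mulrA; apply: ltW.
exact: le_lt_trans uw (nf u w uP wP).
Qed.

(** Rational end points leave only countably many intervals to consider. *)
Lemma small_tail_set_rat (e t : R) : small_tail_set e t ->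
  exists p q : rat, ratr p < t < ratr q /\
    exists F, tail_le_on `]ratr p, ratr q[ F e.
Proof.
move=> [U [oU [F UF]] Ut].
have /nbhs_ballP[r /= r0 rU] : nbhs t U by exact: open_nbhs_nbhs.
have tr : t - r < t by rewrite ltrBlDr ltrDl.
have tr' : t < t + r by rewrite ltrDl.
have [p] := rat_in_itvoo tr; rewrite in_itv/= => /andP[rp pt].
have [q] := rat_in_itvoo tr'; rewrite in_itv/= => /andP[tq qr].
exists p, q; split; first by rewrite pt tq.
exists F => s /=; rewrite in_itv/= => /andP[ps sq]; apply: UF; apply: rU.
by rewrite -ball_normE/= ltr_norml; apply/andP; split; lra.
Qed.

Lemma l1_weakly_discontinuous_negligible : riemann_integrable f ->
  (forall i, mu.-negligible
    [set t | t \in `[0, 1] /\ ~ weakly_continuous_at01 (fun s => f s i) t]) ->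
  mu.-negligible [set t | t \in `[0, 1] /\ ~ weakly_continuous_at01 f t].
Proof.
move=> fint fi.
(* One [F] is fixed per rational interval and tolerance, valid as soon as some finite set is; only
   countably many coordinates arise. *)
have /choice[F Ftail] : forall pqn : rat * rat * nat,
    exists F : seq {classic Gamma}, forall F',
    tail_le_on `]ratr pqn.1.1, ratr pqn.1.2[ F' pqn.2.+1%:R^-1 ->
    tail_le_on `]ratr pqn.1.1, ratr pqn.1.2[ F pqn.2.+1%:R^-1.
  move=> [[p q] n]; have [[F' FF']|noF] := pselect (exists F' : seq {classic Gamma},
      tail_le_on `]ratr p, ratr q[ F' n.+1%:R^-1).
    by exists F'.
  by exists [::] => F' FF'; exfalso; apply: noF; exists F'.
pose D i : set R :=
  [set t | t \in `[0, 1] /\ ~ weakly_continuous_at01 (fun s => f s i) t].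
(* [k] runs over the codes of the pairs of a rational interval with a
   tolerance and a position in the finite set [F] chosen for it. *)
pose Dk (k : nat) : set R :=
  if unpickle k is Some (pqn, m) then
    if onth (F pqn) m is Some i then D i else set0
  else set0.
pose En (n : nat) : set R := `[0, 1] `\` small_tail_set n.+1%:R^-1.
(* Bad points lie in the large-tail sets or in the discontinuity sets of the selected
   coordinates. *)
suff : mu.-negligible (\bigcup_n En n `|` \bigcup_k Dk k).
  apply: negligibleS => t [t01 ft]; apply: contrapT => /not_orP[tE tD]; apply: ft.
  apply: l1_weakly_continuous_at01 => // e e0.
  pose n := Num.truncn e^-1.
  have ne : n.+1%:R^-1 < e by rewrite invf_plt ?posrE//; exact: truncnS_gt.
  have /small_tail_set_rat[p [q [tpq [F' FF']]]] : small_tail_set n.+1%:R^-1 t.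
    by apply: contrapT => tn; apply: tE; exists n.
  exists (F (p, q, n)); split.
    have : \forall s \near t, s \in `]ratr p, ratr q[%R by exact: near_in_itvoo.
    apply: filterS => s spq s01; apply: le_trans (ltW ne).
    exact: (Ftail (p, q, n) F' FF').
  move=> i iF; apply: contrapT => ti; apply: tD.
  have /onthP[m Fm] := iF.
  have DkE pqn : Dk (pickle (pqn, m)) = if onth (F pqn) m is Some j then D j else set0.
    by rewrite /Dk pickleK.
  by exists (pickle (p, q, n, m)); [exact: I|rewrite DkE Fm].
apply: negligibleU; apply: negligible_bigcup => k.
  apply/negligibleP; last by apply: measure_large_tail_set; rewrite ?invr_gt0.
  by apply: measurableD => //; apply: open_measurable; apply: bigcup_open => U [].
rewrite /Dk; case: unpickle => [[pqn m]|]; last exact: negligible_set0.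
by case: onth => [i|]; [exact: fi|exact: negligible_set0].
Qed.

End tail_points.

Theorem theorem2p13 (R : realType) (Gamma : Type)
    (X : Gamma -> completeNormedModType R) :
  (forall i : Gamma, weak_lebesgue_property (X i)) ->
  weak_lebesgue_property (l1_sum X).
Proof.
move=> wX f fint; apply: l1_weakly_discontinuous_negligible => // i.
exact/wX/riemann_integrable_coord.
Qed.
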